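(* For all positive integers $n$ and $b$ there exists a transmission array $\mathcal T$ for $n$ stations and $b$ channels, of length $\mathcal O(n\log n\log^{1/b} n)$, such that the algorithm Wake-Up$(\mathcal T)$ wakes up the network within $\mathcal O(k\log n\log^{1/b}k)$ time steps (counted from the first spontaneous activation), for every $k\le n$ and every activation pattern in which at most $k$ stations are activated spontaneously. The constants in the $\mathcal O$-notation are absolute.
   Context: Model: $n$ stations with distinct names in $\{1,\dots,n\}$ and $b$ channels numbered $1,\dots,b$. Time is divided into synchronous global time steps. In each step each active station may transmit on any subset of channels; all stations listen on all channels. A message on channel $\beta$ in a step is heard by everybody iff exactly one station transmits on $\beta$ in that step; otherwise nothing is heard (no collision detection). Initially all stations are passive; an activation pattern specifies at most $k$ stations and arbitrary time steps $\sigma_u$ at which each such station $u$ becomes active spontaneously. An active station $u$ perceives global time step $t$ as its local round $t-\sigma_u$. The network is woken up at the first time step at which some channel carries a transmission by exactly one station. A transmission array of length $\ell$ is an array of bits $T(u,\beta,j)$ for stations $u$, channels $\beta$ and positions $1\le j\le\ell$. Algorithm Wake-Up$(\mathcal T)$: each activated station $u$, in its local round $j\le\ell$, transmits on channel $\beta$ iff $T(u,\beta,j)=1$, and stops once a message has been heard. The array depends only on $n$ and $b$; $k$ is unknown to the stations. Logarithms are binary.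
   Formalization: Logarithms in the bounds are read as max(1, log), since for k = 1 or n = 1 the stated bounds are zero while at least one step is needed; activation patterns are assumed to activate at least one station. *)

(* Defs.v *)
(* stations are naturals u < n (name u+1), channels are
   naturals beta < b (number beta+1), positions j with 1 <= j <= ell. *)
From Stdlib Require Import Reals List.
Import ListNotations.
Local Open Scope R_scope.
Local Close Scope R_scope.

(* A transmission array: T u beta j = bit T(u,beta,j).  Only the entries
   with u < n, beta < b and 1 <= j <= ell are ever used. *)
Definition tarray := nat -> nat -> nat -> bool.

(* Binary logarithm, clamped below by 1 so that O-bounds with log k,
   log n are meaningful for k = 1 or n = 1. *)
Definition lg (x : nat) : R := Rmax 1 (ln (INR x) / ln 2)%R.

(* Under Wake-Up(T) with activation pattern (A, sigma), before the network is
   woken up (no message heard yet), station u transmits on channel beta at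
   global step t iff u was activated, its local round j = t - sigma u
   satisfies 1 <= j <= ell, and T u beta j = true. *)
Definition transmits (ell : nat) (T : tarray) (A : list nat) (sigma : nat -> nat)
    (u beta t : nat) : Prop :=
  In u A /\ (sigma u < t)%nat /\ (t - sigma u <= ell)%nat /\
  T u beta (t - sigma u) = true.

(* Step t wakes the network: some channel carries a transmission by exactly
   one station.  (The wake-up time is the first such t; before it, every
   active station follows the array, so [transmits] is the actual behaviour.) *)
Definition wakes_at (b ell : nat) (T : tarray) (A : list nat) (sigma : nat -> nat)
    (t : nat) : Prop :=
  exists beta, (beta < b)%nat /\
    exists u, transmits ell T A sigma u beta t /\
      forall v, transmits ell T A sigma v beta t -> v = u.

(* Main.v *)
Require Import Defs.
From Stdlib Require Import Reals List Lra Lia ClassicalEpsilon.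
Import ListNotations.
Open Scope R_scope.

(** Probabilistic method.  With [a i] about [i ^ (1/b)], the local rounds of a station are cut
into sections, the [i]-th ending at round [H i = D * 2 ^ i * a i], where [D] is of order
[log n]; in section [i] a station transmits on channel [beta] (numbered from 0)
independently with probability [p = 1 / (2 ^ i * (2 * a i) ^ (beta + 1))].

Given a pattern, let [m] be least such that at most [2 ^ m] stations are activated during
the first [H m] steps, so that [2 ^ m < 2 * k] unless [m = 0].  After step [H (m - 1)] at least
[2 ^ (m - 1)] stations are active and none is beyond section [m], so on channel 0 the
sum of the transmission probabilities is at least [1 / (4 * a m)].  On the last channel a single
station accumulates at most [D * a m] up to round [H m], so the sum there is on average at
most 1, hence at most 4 during a quarter of the [H m] steps after [H (m - 1)].  Since
consecutive channels differ by a factor at most [2 * a m], in each of these steps some channel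
has its sum between [1 / (4 * a m)] and 4, and a station is isolated on it with probability at
least [exp (-8) / (4 * a m)].  Distinct steps read distinct bits of the array, so they all
fail with probability at most [exp (- exp (-8) * D * 2 ^ m / 16)], which beats the number
[(n * H m + 1) ^ (2 ^ m)] of patterns. *)

(** * Sums over lists *)

Definition lsum {A : Type} (f : A -> R) (l : list A) : R :=
  fold_right (fun x s => f x + s) 0 l.

Lemma lsum_app {A : Type} (f : A -> R) (l l' : list A) :
  lsum f (l ++ l') = lsum f l + lsum f l'.
Proof. induction l as [|x l IH]; simpl; [|rewrite IH]; lra. Qed.

Lemma lsum_add {A : Type} (f g : A -> R) (l : list A) :
  lsum (fun x => f x + g x) l = lsum f l + lsum g l.
Proof. induction l as [|x l IH]; simpl; [|rewrite IH]; lra. Qed.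

Lemma lsum_le {A : Type} (f g : A -> R) (l : list A) :
  (forall x, In x l -> f x <= g x) -> lsum f l <= lsum g l.
Proof.
  induction l as [|x l IH]; simpl; intros H; [lra|].
  pose proof (H x (or_introl eq_refl)).
  assert (lsum f l <= lsum g l) by (apply IH; auto). lra.
Qed.

Lemma lsum_ext {A : Type} (f g : A -> R) (l : list A) :
  (forall x, In x l -> f x = g x) -> lsum f l = lsum g l.
Proof. intros H; apply Rle_antisym; apply lsum_le; intros x Hx; rewrite (H x Hx); lra. Qed.

Lemma lsum_const {A : Type} (c : R) (l : list A) :
  lsum (fun _ => c) l = INR (length l) * c.
Proof.
  induction l as [|x l IH]; [simpl; lra|].
  simpl lsum; simpl length. rewrite IH, S_INR; lra.
Qed.

Lemma lsum_nonneg {A : Type} (f : A -> R) (l : list A) :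
  (forall x, In x l -> 0 <= f x) -> 0 <= lsum f l.
Proof.
  intros H. apply Rle_trans with (lsum (fun _ => 0) l); [rewrite lsum_const; lra|].
  now apply lsum_le.
Qed.

Lemma lsum_mult_l {A : Type} (c : R) (f : A -> R) (l : list A) :
  lsum (fun x => c * f x) l = c * lsum f l.
Proof. induction l as [|x l IH]; simpl; [|rewrite IH]; lra. Qed.

Lemma lsum_swap {A B : Type} (f : A -> B -> R) (l : list A) (l' : list B) :
  lsum (fun x => lsum (f x) l') l = lsum (fun y => lsum (fun x => f x y) l) l'.
Proof.
  induction l as [|x l IH]; simpl.
  - rewrite lsum_const; lra.
  - rewrite IH. symmetry. apply (lsum_add (f x) (fun y => lsum (fun x => f x y) l)).
Qed.

Lemma lsum_map {A B : Type} (h : A -> B) (f : B -> R) (l : list A) :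
  lsum f (map h l) = lsum (fun x => f (h x)) l.
Proof. induction l as [|x l IH]; simpl; [|rewrite IH]; lra. Qed.

Lemma lsum_filter {A : Type} (q : A -> bool) (f : A -> R) (l : list A) :
  lsum f (filter q l) = lsum (fun x => if q x then f x else 0) l.
Proof. induction l as [|x l IH]; simpl; [lra|]. destruct (q x); simpl; rewrite IH; lra. Qed.

Lemma lsum_filter_le {A : Type} (q : A -> bool) (f : A -> R) (l : list A) :
  (forall x, In x l -> 0 <= f x) -> lsum f (filter q l) <= lsum f l.
Proof.
  intros H. rewrite lsum_filter. apply lsum_le; intros x Hx.
  specialize (H x Hx). destruct (q x); lra.
Qed.

(** * Independent random bits *)

Definition upd {X : Type} (dec : forall x y : X, {x = y} + {x <> y})
    (w : X -> bool) (x : X) (v : bool) : X -> bool :=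
  fun y => if dec x y then v else w y.

(* The expectation of [f] when the bits in [l] are independent, bit [x] being
   [true] with probability [p x], and all the other bits are read off [w]. *)
Fixpoint expect {X : Type} (dec : forall x y : X, {x = y} + {x <> y}) (p : X -> R)
    (l : list X) (f : (X -> bool) -> R) (w : X -> bool) : R :=
  match l with
  | [] => f w
  | x :: l' => p x * expect dec p l' f (upd dec w x true)
               + (1 - p x) * expect dec p l' f (upd dec w x false)
  end.

(** Measurability with respect to the bits in [S]; functions that depend on disjoint sets of bits
    are independent. *)
Definition depends_on {X : Type} (S : X -> Prop) (f : (X -> bool) -> R) : Prop :=
  forall w w', (forall x, S x -> w x = w' x) -> f w = f w'.

Section Expectation.
Context {X : Type} (dec : forall x y : X, {x = y} + {x <> y}) (p : X -> R).
Hypothesis p01 : forall x, 0 <= p x <= 1.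

Notation E := (expect dec p).

Lemma expect_add (l : list X) (f g : (X -> bool) -> R) (w : X -> bool) :
  E l (fun w => f w + g w) w = E l f w + E l g w.
Proof. revert w; induction l as [|x l IH]; simpl; intros w; [|rewrite !IH]; lra. Qed.

Lemma expect_const (l : list X) (c : R) (w : X -> bool) : E l (fun _ => c) w = c.
Proof. revert w; induction l as [|x l IH]; simpl; intros w; [|rewrite !IH]; lra. Qed.

Lemma expect_mono (l : list X) (f g : (X -> bool) -> R) (w : X -> bool) :
  (forall w, f w <= g w) -> E l f w <= E l g w.
Proof.
  intros H; revert w; induction l as [|x l IH]; simpl; intros w; [apply H|].
  pose proof (p01 x). apply Rplus_le_compat; apply Rmult_le_compat_l; try apply IH; lra.
Qed.

Lemma expect_ext (l : list X) (f g : (X -> bool) -> R) (w : X -> bool) :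
  (forall w, f w = g w) -> E l f w = E l g w.
Proof. intros H; apply Rle_antisym; apply expect_mono; intros; rewrite H; lra. Qed.

(** The existence step of the probabilistic method: if no assignment gave a value below [c],
    monotonicity would push the average up to [c]. *)
Lemma expect_lt_exists (l : list X) (f : (X -> bool) -> R) (w : X -> bool) (c : R) :
  E l f w < c -> exists w', f w' < c.
Proof.
  intros H. apply NNPP; intros N.
  assert (c <= E l f w); [|lra].
  rewrite <- (expect_const l c w). apply expect_mono. intros w'.
  apply Rnot_lt_le; intros Hw; apply N; now exists w'.
Qed.

Lemma expect_depends_on (S : X -> Prop) (l : list X) (f : (X -> bool) -> R) :
  depends_on S f -> depends_on S (E l f).
Proof.
  intros Hf; induction l as [|x l IH]; simpl; [exact Hf|].
  intros w w' Hw. f_equal; f_equal; apply IH; intros y Hy; unfold upd;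
    destruct (dec x y); auto.
Qed.

Lemma expect_upd_out (S : X -> Prop) (x : X) (l : list X) (f : (X -> bool) -> R)
    (w : X -> bool) (v : bool) :
  depends_on S f -> ~ S x -> E l f (upd dec w x v) = E l f w.
Proof.
  intros Hf Hx. apply (expect_depends_on S l f Hf). intros y Hy. unfold upd.
  destruct (dec x y); congruence.
Qed.

(** Independence. Each bit lies on one side only, so fixing it leaves the expectation of the other
    factor unchanged, and that factor comes out of the two-branch average. *)
Lemma expect_mult (S : X -> Prop) (l : list X) (f g : (X -> bool) -> R) (w : X -> bool) :
  depends_on S f -> depends_on (fun x => ~ S x) g ->
  E l (fun w => f w * g w) w = E l f w * E l g w.
Proof.
  intros Hf Hg; revert w; induction l as [|x l IH]; simpl; intros w; [lra|].
  rewrite !IH. destruct (classic (S x)) as [Hx|Hx].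
  - rewrite !(expect_upd_out _ x l g w _ Hg) by tauto. ring.
  - rewrite !(expect_upd_out _ x l f w _ Hf) by tauto. ring.
Qed.

Lemma expect_bit (l : list X) (x : X) (a c : R) (w : X -> bool) :
  In x l -> E l (fun w => if w x then a else c) w = p x * a + (1 - p x) * c.
Proof.
  revert w; induction l as [|y l IH]; intros w Hx; [easy|].
  (* If [x] occurs again further on, the later update overwrites this one, so repetitions in [l] are
     harmless. *)
  destruct (in_dec dec x l) as [Hl|Hl]; simpl; [rewrite !IH by auto; ring|].
  destruct Hx as [->|Hx]; [|easy].
  assert (Hout : forall w, E l (fun w => if w x then a else c) w = if w x then a else c).
  { clear IH; induction l as [|z l IHl]; simpl; intros w'; [easy|].
    rewrite !IHl by (intros H; apply Hl; now right).
    unfold upd; destruct (dec z x) as [->|_]; [exfalso; apply Hl; now left|ring]. }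
  rewrite !Hout. unfold upd. destruct (dec x x); [ring|easy].
Qed.

(** Factors are split off one at a time: by disjointness the product of the others depends only on
    bits outside [S t]. *)
Lemma expect_prod {T : Type} (S : T -> X -> Prop) (f : T -> (X -> bool) -> R)
    (l : list X) (c : R) (ts : list T) (w : X -> bool) :
  NoDup ts ->
  (forall t, In t ts -> depends_on (S t) (f t)) ->
  (forall t t' x, In t ts -> In t' ts -> S t x -> S t' x -> t = t') ->
  (forall t w, In t ts -> 0 <= E l (f t) w <= c) ->
  0 <= E l (fun w => fold_right (fun t s => f t w * s) 1 ts) w <= c ^ length ts.
Proof.
  intros Hnd Hdep Hdisj Hc; revert w.
  induction Hnd as [|t ts Ht Hnd IH]; intros w; simpl.
  - rewrite expect_const; lra.
  - rewrite (expect_mult (S t)).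
    + pose proof (Hc t w (or_introl eq_refl)) as H1.
      assert (H2 : 0 <= E l (fun w => fold_right (fun t s => f t w * s) 1 ts) w
                   <= c ^ length ts).
      { apply IH; intros; [apply Hdep|eapply Hdisj|apply Hc]; eauto; now right. }
      split; [apply Rmult_le_pos|apply Rmult_le_compat]; lra.
    + apply Hdep; now left.
    + intros w1 w2 Hw.
      assert (Hs : forall t', In t' ts -> f t' w1 = f t' w2).
      { intros t' Ht'. apply (Hdep t' (or_intror Ht')). intros x Hx. apply Hw. intros Hx'.
        apply Ht. rewrite (Hdisj t t' x); auto; [now left|now right]. }
      clear -Hs. induction ts as [|t' ts IH]; simpl; [easy|].
      rewrite Hs by now left. rewrite IH; [easy|]. intros; apply Hs; now right.
Qed.

Definition indicator (v : bool) : R := if v then 1 else 0.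

Definition count_is (m : nat) (cs : list X) (w : X -> bool) : bool :=
  Nat.eqb (length (filter w cs)) m.

Lemma count_is_depends (m : nat) (cs : list X) :
  depends_on (fun x => In x cs) (fun w => indicator (count_is m cs w)).
Proof. intros w w' H. unfold count_is. now rewrite (filter_ext_in w w' cs H). Qed.

(** Passes through [/ (1 + 2 * x)], since (1 + 2x)(1 - x) = 1 + x(1 - 2x) is at least 1. *)
Lemma one_minus_ge_exp (x : R) : 0 <= x <= 1 / 2 -> exp (- (2 * x)) <= 1 - x.
Proof.
  intros Hx. rewrite exp_Ropp.
  assert (H : 1 + 2 * x <= exp (2 * x)).
  { destruct (Req_dec x 0) as [->|H0]; [rewrite Rmult_0_r, exp_0; lra|].
    left; apply exp_ineq1; lra. }
  apply Rle_trans with (/ (1 + 2 * x)); [apply Rinv_le_contravar; lra|].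
  apply Rmult_le_reg_l with (1 + 2 * x); [lra|]. rewrite Rinv_r by lra. nra.
Qed.

(** The chance of no true bit is the product of the 1 - p, at least exp(-2 sum p). The chance of
    exactly one is that product times the sum of p / (1 - p), hence at least sum p times it. *)
Lemma expect_isolation (l cs : list X) (w : X -> bool) :
  NoDup cs -> (forall x, In x cs -> In x l) -> (forall x, In x cs -> p x <= 1 / 2) ->
  lsum p cs * exp (- (2 * lsum p cs)) <= E l (fun w => indicator (count_is 1 cs w)) w.
Proof.
  intros Hnd Hin Hp.
  enough (H : 0 <= lsum p cs /\
    exp (- (2 * lsum p cs)) <= E l (fun w => indicator (count_is 0 cs w)) w /\
    lsum p cs * E l (fun w => indicator (count_is 0 cs w)) w
      <= E l (fun w => indicator (count_is 1 cs w)) w).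
  { destruct H as (H0 & H1 & H2). eapply Rle_trans; [|exact H2].
    now apply Rmult_le_compat_l. }
  induction Hnd as [|x cs Hx Hnd IH].
  - change (0 <= 0 /\ exp (- (2 * 0)) <= E l (fun _ => 1) w
            /\ 0 * E l (fun _ => 1) w <= E l (fun _ => 0) w).
    rewrite !expect_const. rewrite Rmult_0_r, Ropp_0, exp_0; lra.
  - destruct IH as (H0 & H1 & H2); [intros; apply Hin; now right|intros; apply Hp; now right|].
    assert (Hpx := conj (p01 x) (Hp x (or_introl eq_refl))).
    assert (Hl : In x l) by (apply Hin; now left).
    assert (Hout : forall m, depends_on (fun y => y <> x)
                               (fun w => indicator (count_is m cs w))).
    { intros m w1 w2 Hw. apply count_is_depends. intros y Hy. apply Hw. now intros ->. }
    assert (Hbit : forall a c, depends_on (fun y => ~ y <> x)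
                                 (fun w : X -> bool => if w x then a else c)).
    { intros a c w1 w2 Hw. rewrite (Hw x); tauto. }
    assert (E0 : E l (fun w => indicator (count_is 0 (x :: cs) w)) w
                 = E l (fun w => indicator (count_is 0 cs w)) w * (1 - p x)).
    { rewrite (expect_ext _ _ (fun w => indicator (count_is 0 cs w) * (if w x then 0 else 1))).
      - rewrite (expect_mult (fun y => y <> x)), expect_bit by auto. ring.
      - intros w'. unfold count_is; simpl. destruct (w' x); simpl; ring. }
    assert (E1 : E l (fun w => indicator (count_is 1 (x :: cs) w)) w
                 = E l (fun w => indicator (count_is 0 cs w)) w * p x
                   + E l (fun w => indicator (count_is 1 cs w)) w * (1 - p x)).
    { rewrite (expect_ext _ _ (fun w => indicator (count_is 0 cs w) * (if w x then 1 else 0)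
                                      + indicator (count_is 1 cs w) * (if w x then 0 else 1))).
      - rewrite expect_add, !(expect_mult (fun y => y <> x)), !expect_bit by auto. ring.
      - intros w'. unfold count_is; simpl. destruct (w' x); simpl; ring. }
    rewrite E0, E1. simpl lsum.
    pose proof (exp_pos (- (2 * lsum p cs))) as He.
    assert (Hx2 := one_minus_ge_exp (p x) ltac:(lra)).
    assert (Hpos := exp_pos (- (2 * p x))).
    set (q := E l (fun w => indicator (count_is 0 cs w)) w) in *.
    set (r := E l (fun w => indicator (count_is 1 cs w)) w) in *.
    split; [lra|split].
    + replace (- (2 * (p x + lsum p cs)))
        with (- (2 * lsum p cs) + - (2 * p x)) by ring.
      rewrite exp_plus. apply Rmult_le_compat; lra.
    (* The two asserted nonnegative terms add up to exactly the difference of the two sides. *)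
    + assert (0 <= (r - lsum p cs * q) * (1 - p x)) by (apply Rmult_le_pos; lra).
      assert (0 <= q * (p x * p x)) by (apply Rmult_le_pos; nra). nra.
Qed.

End Expectation.

(** * Failure probabilities and the union bound *)

(* [Q] holds outside an event of probability at most [e]; [f] plays the role of
   (an upper bound of) the indicator function of that event. *)
Definition fails_within {X : Type} (dec : forall x y : X, {x = y} + {x <> y})
    (p : X -> R) (l : list X) (e : R) (Q : (X -> bool) -> Prop) : Prop :=
  exists f, (forall w, 0 <= f w) /\ (forall w, expect dec p l f w <= e) /\
    forall w, f w < 1 -> Q w.

(** Union bound: the failure functions are added, and since all are nonnegative, a sum below 1
    forces each of them below 1. *)
Lemma fails_within_all {X T : Type} (dec : forall x y : X, {x = y} + {x <> y})
    (p : X -> R) (l : list X) (e : T -> R) (Q : T -> (X -> bool) -> Prop) (ts : list T) :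
  (forall t, In t ts -> fails_within dec p l (e t) (Q t)) ->
  fails_within dec p l (lsum e ts) (fun w => forall t, In t ts -> Q t w).
Proof.
  induction ts as [|t ts IH]; intros H.
  - exists (fun _ => 0). split; [intros; lra|]. split; [|easy].
    intros w; rewrite expect_const; simpl; lra.
  - destruct (H t) as (f & f0 & fe & fQ); [now left|].
    destruct IH as (g & g0 & ge & gQ); [intros; apply H; now right|].
    exists (fun w => f w + g w). split; [|split].
    + intros w; specialize (f0 w); specialize (g0 w); lra.
    + intros w; rewrite expect_add. simpl. specialize (fe w); specialize (ge w); lra.
    + intros w Hw t' [<-|Ht'].
      * apply fQ. specialize (g0 w); lra.
      * apply gQ; [|easy]. specialize (f0 w); lra.
Qed.

(** The same list may occur several times; this recursion makes the count a plain power of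
    [length d + 1], ready for the union bound. *)
Fixpoint lists_upto {A : Type} (d : list A) (N : nat) : list (list A) :=
  match N with
  | O => [[]]
  | S N' => lists_upto d N' ++ flat_map (fun l => map (fun x => x :: l) d) (lists_upto d N')
  end.

Lemma length_lists_upto {A : Type} (d : list A) (N : nat) :
  length (lists_upto d N) = Nat.pow (S (length d)) N.
Proof.
  induction N as [|N IH]; simpl; [easy|].
  rewrite length_app, <- IH.
  rewrite (flat_map_constant_length (c := length d)) by (intros; apply length_map). lia.
Qed.

Lemma in_lists_upto {A : Type} (d : list A) (N : nat) (l : list A) :
  (length l <= N)%nat -> incl l d -> In l (lists_upto d N).
Proof.
  revert l; induction N as [|N IH]; intros l Hl Hd; simpl.
  - destruct l; simpl in Hl; [now left|lia].
  - apply in_or_app. destruct l as [|x l]; [left; apply IH; simpl; auto; lia|right].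
    apply in_flat_map. exists l. split.
    + apply IH; [simpl in Hl; lia|]. intros y Hy; apply Hd; now right.
    + apply (in_map (fun x => x :: l)). apply Hd; now left.
Qed.

(** * Section lengths and transmission probabilities *)

(* The least [a >= 1] with [m <= a ^ b]. *)
Fixpoint root (b m : nat) : nat :=
  match m with
  | O => 1
  | S m' => if Nat.ltb (Nat.pow (root b m') b) m then S (root b m') else root b m'
  end.

(** Raising the root by one suffices when [m] grows by one, because consecutive [b]-th powers differ
    by at least one. The last bound is an equality at [m = 0]. *)
Lemma root_spec (b m : nat) : (1 <= b)%nat ->
  (1 <= root b m)%nat /\ (m <= Nat.pow (root b m) b)%nat
  /\ (Nat.pow (root b m - 1) b <= m)%nat.
Proof.
  intros Hb. induction m as [|m (H1 & H2 & H3)].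
  - simpl. rewrite Nat.pow_0_l by lia. lia.
  - cbn [root]. destruct (Nat.ltb_spec (Nat.pow (root b m) b) (S m)) as [H|H].
    + assert (Nat.pow (root b m) b < Nat.pow (S (root b m)) b)%nat
        by (apply Nat.pow_lt_mono_l; lia).
      replace (S (root b m) - 1)%nat with (root b m) by lia. lia.
    + lia.
Qed.

Lemma root_mono (b m m' : nat) : (m <= m')%nat -> (root b m <= root b m')%nat.
Proof.
  induction 1 as [|m' _ IH]; [lia|]. cbn [root].
  destruct (Nat.ltb _ _); lia.
Qed.

Lemma root_le (b m : nat) : (root b m <= S m)%nat.
Proof. induction m as [|m IH]; cbn [root]; [lia|]. destruct (Nat.ltb _ _); lia. Qed.

(** The mean value theorem would give the factor [c + 1]; the cruder [2 ^ c] is what the base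
    [2 * a] of the transmission probabilities can absorb. *)
Lemma pow_diff_le (a : R) (c : nat) : 1 <= a -> a ^ S c - (a - 1) ^ S c <= 2 ^ c * a ^ c.
Proof.
  intros Ha. induction c as [|c IH]; [simpl; lra|].
  assert (H : (a - 1) ^ S c <= a ^ S c) by (apply pow_incr; lra).
  assert (H2 : 1 <= 2 ^ c) by (apply pow_R1_Rle; lra).
  assert (H3 : 0 < a ^ S c) by (apply pow_lt; lra).
  replace (a ^ S (S c) - (a - 1) ^ S (S c))
    with (a * (a ^ S c - (a - 1) ^ S c) + (a - 1) ^ S c) by (simpl; ring).
  apply Rle_trans with (a * (2 ^ c * a ^ c) + a ^ S c).
  - apply Rplus_le_compat; [|easy]. apply Rmult_le_compat_l; lra.
  - replace (a * (2 ^ c * a ^ c)) with (2 ^ c * a ^ S c) by (simpl; ring).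
    replace (2 ^ S c * a ^ S c) with (2 ^ c * a ^ S c + 2 ^ c * a ^ S c) by (simpl; ring).
    nra.
Qed.

Lemma exp_pow (x : R) (N : nat) : exp x ^ N = exp (INR N * x).
Proof.
  induction N as [|N IH].
  - simpl. now rewrite Rmult_0_l, exp_0.
  - rewrite S_INR. simpl pow. rewrite IH, <- exp_plus. f_equal; ring.
Qed.

Lemma two_le_exp1 : 2 <= exp 1.
Proof. pose proof (exp_ineq1 1 ltac:(lra)). lra. Qed.

Section Array.
Variables (b D L : nat).
Hypothesis hb : (1 <= b)%nat.
Hypothesis hD : (1 <= D)%nat.

Definition horizon (m : nat) : nat := (D * (Nat.pow 2 m * root b m))%nat.

Definition window_start (m : nat) : nat :=
  match m with O => O | S m' => horizon m' end.

(* The section of local round [j]: the least [i <= M] with [j <= horizon i], if any. *)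
Fixpoint level (M j : nat) : nat :=
  match M with
  | O => O
  | S M' => if Nat.leb j (horizon M') then level M' j else M
  end.

Definition aR (m : nat) : R := INR (root b m).

(* Local rounds start at 1; the value 0 at round 0 lets [t - s] be truncated for the
   stations activated at [s >= t]. *)
Definition prob (beta j : nat) : R :=
  match j with
  | O => 0
  | S _ => / (2 ^ level L j * (2 * aR (level L j)) ^ S beta)
  end.

Lemma horizon_double (m : nat) : (2 * horizon m <= horizon (S m))%nat.
Proof.
  unfold horizon. pose proof (root_mono b m (S m) ltac:(lia)).
  rewrite Nat.pow_succ_r'.
  apply Nat.le_trans with (D * (2 * Nat.pow 2 m * root b m))%nat; [lia|].
  apply Nat.mul_le_mono_l, Nat.mul_le_mono_l; easy.
Qed.

Lemma horizon_mono (m m' : nat) : (m <= m')%nat -> (horizon m <= horizon m')%nat.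
Proof. induction 1 as [|m' _ IH]; [lia|]. pose proof (horizon_double m'); lia. Qed.

Lemma window_start_half (m : nat) : (2 * window_start m <= horizon m)%nat.
Proof. destruct m as [|m]; simpl window_start; [lia|apply horizon_double]. Qed.

Lemma level_le (M m j : nat) : (j <= horizon m)%nat -> (level M j <= m)%nat.
Proof.
  intros Hj. induction M as [|M IH]; simpl; [lia|].
  destruct (Nat.leb_spec j (horizon M)) as [H|H]; [easy|].
  destruct (Nat.le_gt_cases m M) as [Hm|Hm]; [|lia].
  pose proof (horizon_mono _ _ Hm); lia.
Qed.

Lemma level_gt (M m j : nat) : (m < M)%nat -> (horizon m < j)%nat -> (m < level M j)%nat.
Proof.
  intros Hm Hj. induction M as [|M IH]; simpl; [lia|].
  destruct (Nat.leb_spec j (horizon M)) as [H|H]; [|lia].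
  apply IH. destruct (Nat.eq_dec m M) as [->|]; lia.
Qed.

Lemma aR_ge1 (m : nat) : 1 <= aR m.
Proof. apply (le_INR 1). apply (root_spec b m hb). Qed.

Lemma aR_mono (m m' : nat) : (m <= m')%nat -> aR m <= aR m'.
Proof. intros H. apply le_INR. now apply root_mono. Qed.

Lemma INR_horizon (m : nat) : INR (horizon m) = INR D * (2 ^ m * aR m).
Proof. unfold horizon. now rewrite !mult_INR, pow_INR. Qed.

Lemma prob_pos (beta j : nat) : 0 <= prob beta j.
Proof.
  destruct j as [|j]; simpl; [lra|]. left. apply Rinv_0_lt_compat.
  pose proof (aR_ge1 (level L (S j))).
  apply Rmult_lt_0_compat; [apply pow_lt; lra|apply (pow_lt _ (S beta)); lra].
Qed.

(** The 2 in the base [2 * aR i] ensures this even when [2 ^ i] and [aR i] are 1; [expect_isolation]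
    relies on it. *)
Lemma prob_half (beta j : nat) : prob beta j <= 1 / 2.
Proof.
  destruct j as [|j]; [simpl; lra|].
  unfold prob. set (i := level L (S j)). pose proof (aR_ge1 i) as Ha.
  replace (1 / 2) with (/ 2) by lra. apply Rinv_le_contravar; [lra|].
  assert (1 <= 2 ^ i) by (apply pow_R1_Rle; lra).
  assert (1 <= (2 * aR i) ^ beta) by (apply pow_R1_Rle; lra).
  simpl pow. assert (1 <= 2 ^ i * (2 * aR i) ^ beta) by nra. nra.
Qed.

Lemma prob_first_ge (m j : nat) : (1 <= j <= horizon m)%nat ->
  / (2 ^ m * (2 * aR m)) <= prob 0 j.
Proof.
  intros Hj. destruct j as [|j]; [lia|]. unfold prob.
  pose proof (level_le L m (S j) ltac:(lia)) as Hl. set (i := level L (S j)) in *.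
  pose proof (aR_ge1 i) as Ha. pose proof (aR_mono _ _ Hl).
  assert (1 <= 2 ^ i) by (apply pow_R1_Rle; lra).
  assert (2 ^ i <= 2 ^ m) by (apply Rle_pow; [lra|easy]).
  rewrite pow_1. apply Rinv_le_contravar; [nra|]. apply Rmult_le_compat; lra.
Qed.

Lemma prob_next_ge (m beta j : nat) : (j <= horizon m)%nat ->
  prob beta j * / (2 * aR m) <= prob (S beta) j.
Proof.
  intros Hj. destruct j as [|j]; [simpl; lra|].
  pose proof (prob_pos beta (S j)) as Hp. unfold prob in *.
  pose proof (level_le L m (S j) ltac:(lia)) as Hl. set (i := level L (S j)) in *.
  pose proof (aR_ge1 i) as Ha. pose proof (aR_mono _ _ Hl).
  assert (0 < 2 ^ i) by (apply pow_lt; lra).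
  assert (0 < (2 * aR i) ^ S beta) by (apply pow_lt; lra).
  replace (2 ^ i * (2 * aR i) ^ S (S beta)) with (2 ^ i * (2 * aR i) ^ S beta * (2 * aR i))
    by (simpl; ring).
  rewrite (Rinv_mult (_ * _)). apply Rmult_le_compat_l; [easy|].
  apply Rinv_le_contravar; lra.
Qed.

(* Sections [i] with the same root [a] contribute [a / (2 a) ^ b] each, and there are
   [a ^ b - (a - 1) ^ b <= b * a ^ (b - 1)] of them, hence each value of [a]
   contributes at most [b / 2 ^ b <= 1 / 2]. *)
Lemma load_le (m : nat) : (m <= L)%nat ->
  lsum (prob (b - 1)) (seq 1 (horizon m)) <= INR D * aR m.
Proof.
  intros Hm.
  (* One section with root [a] contributes at most [INR D * r a]: it has at most [horizon i] rounds,
     all with the same probability. *)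
  set (r := fun a : R => a / (2 * a) ^ b).
  (* A potential: [aR m - 1 / 2] pays for section 0 and the completed root values, the last term for
     the sections seen with the current root. It stays below [aR m] and grows with each section by
     at least that section's share. *)
  set (phi := fun m => aR m - 1 / 2 + (INR m - (aR m - 1) ^ b) * r (aR m)).
  assert (Hr : forall a, 1 <= a -> 0 < r a /\ (a ^ b - (a - 1) ^ b) * r a <= 1 / 2).
  { intros a Ha. unfold r. destruct b as [|c]; [lia|].
    assert (0 < a ^ c) by (apply pow_lt; lra). assert (0 < 2 ^ c) by (apply pow_lt; lra).
    assert (E : a / (2 * a) ^ S c = / (2 * (2 ^ c * a ^ c))).
    { rewrite Rpow_mult_distr. simpl. field. repeat split; lra. }
    rewrite E. assert (0 < 2 ^ c * a ^ c) by nra. split; [apply Rinv_0_lt_compat; lra|].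
    apply Rmult_le_reg_r with (2 * (2 ^ c * a ^ c)); [lra|].
    rewrite Rmult_assoc, Rinv_l by lra. pose proof (pow_diff_le a c Ha). lra. }
  assert (Hpow : forall m, INR m <= aR m ^ b /\ (aR m - 1) ^ b <= INR m).
  { intros m'. destruct (root_spec b m' hb) as (H1 & H2 & H3). unfold aR. split.
    - rewrite <- pow_INR. now apply le_INR.
    - rewrite <- (minus_INR _ 1) by easy. rewrite <- pow_INR. now apply le_INR. }
  enough (H : lsum (prob (b - 1)) (seq 1 (horizon m)) <= INR D * phi m).
  { eapply Rle_trans; [exact H|]. apply Rmult_le_compat_l; [apply pos_INR|].
    destruct (Hr (aR m) (aR_ge1 m)) as [H1 H2]. destruct (Hpow m) as [H3 H4].
    unfold phi. nra. }
  assert (Hlast : forall i j, level L (S j) = i ->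
            prob (b - 1) (S j) * INR (horizon i) = INR D * r (aR i)).
  { intros i j Hi. unfold prob. rewrite Hi, INR_horizon. replace (S (b - 1)) with b by lia.
    unfold r. pose proof (aR_ge1 i). assert (0 < 2 ^ i) by (apply pow_lt; lra).
    assert (0 < (2 * aR i) ^ b) by (apply pow_lt; lra). field. lra. }
  assert (Hblock : forall i s d, (d <= horizon i)%nat ->
            (forall j, In j (seq (S s) d) -> level L j = i) ->
            lsum (prob (b - 1)) (seq (S s) d) <= INR D * r (aR i)).
  { intros i s d Hd Hl. destruct d as [|d].
    - simpl. pose proof (proj1 (Hr _ (aR_ge1 i))). pose proof (pos_INR D). nra.
    - assert (Hh : 0 < INR (horizon i)) by (apply lt_0_INR; lia).
      apply Rle_trans with (lsum (fun _ => INR D * r (aR i) / INR (horizon i)) (seq (S s) (S d))).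
      + apply lsum_le. intros j Hj. pose proof Hj as Hj'. apply in_seq in Hj'.
        destruct j as [|j]; [lia|]. rewrite <- (Hlast i j) by auto. right; field. lra.
      + rewrite lsum_const, length_seq.
        apply le_INR in Hd. pose proof (proj1 (Hr _ (aR_ge1 i))). pose proof (pos_INR D).
        apply Rmult_le_reg_r with (INR (horizon i)); [easy|].
        replace (INR (S d) * (INR D * r (aR i) / INR (horizon i)) * INR (horizon i))
          with (INR (S d) * (INR D * r (aR i))) by (field; lra).
        rewrite Rmult_comm. apply Rmult_le_compat_l; [nra|easy]. }
  induction m as [|m IH].
  - apply Rle_trans with (INR D * r (aR 0)).
    + apply Hblock; [easy|]. intros j Hj. apply in_seq in Hj.
      pose proof (level_le L 0 j ltac:(lia)). lia.
    + apply Rmult_le_compat_l; [apply pos_INR|]. unfold phi.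
      destruct (Hr 1 ltac:(lra)) as [_ Hr1]. unfold aR; simpl root.
      change (INR 1) with 1 in *. change (INR 0) with 0.
      rewrite pow1, Rminus_diag, pow_i in * by lia. lra.
  - specialize (IH ltac:(lia)). pose proof (horizon_mono m (S m) ltac:(lia)) as Hh.
    replace (horizon (S m)) with (horizon m + (horizon (S m) - horizon m))%nat by lia.
    rewrite seq_app, lsum_app.
    assert (Hb : lsum (prob (b - 1)) (seq (1 + horizon m) (horizon (S m) - horizon m))
                 <= INR D * r (aR (S m))).
    { apply Hblock; [lia|]. intros j Hj. apply in_seq in Hj.
      pose proof (level_le L (S m) j ltac:(lia)).
      pose proof (level_gt L m j ltac:(lia) ltac:(lia)). lia. }
    enough (phi m + r (aR (S m)) <= phi (S m)).
    { pose proof (pos_INR D). nra. }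
    destruct (Hr (aR m) (aR_ge1 m)) as [H1 H2]. destruct (Hpow m) as [H3 H4].
    unfold phi. rewrite S_INR.
    assert (Hcase : aR (S m) = aR m \/ aR (S m) = aR m + 1 /\ (aR m) ^ b <= INR m).
    { unfold aR. cbn [root].
      destruct (Nat.ltb_spec (Nat.pow (root b m) b) (S m)) as [H|H]; [right|now left].
      rewrite S_INR, <- pow_INR. split; [easy|]. apply le_INR; lia. }
    (* The root grows only at [INR m = aR m ^ b]; the sections with the old root are then complete
       and cost at most 1/2 together. *)
    destruct Hcase as [E|[E Hm']]; rewrite E; [lra|].
    replace (aR m + 1 - 1) with (aR m) by ring.
    assert (INR m = aR m ^ b) as -> by lra.
    destruct (Hr (aR m + 1)) as [H5 _]; [pose proof (aR_ge1 m); lra|]. lra.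
Qed.


(** * Activation patterns *)

Definition coord_dec : forall x y : nat * nat * nat, {x = y} + {x <> y}.
Proof. repeat decide equality. Defined.

Definition bit_prob (x : nat * nat * nat) : R := prob (snd (fst x)) (snd x).

(* [P] lists pairs (station, activation time relative to the first activation). *)
Definition step_bits (P : list (nat * nat)) (beta t : nat) : list (nat * nat * nat) :=
  map (fun us => (fst us, beta, (t - snd us)%nat)) (filter (fun us => Nat.ltb (snd us) t) P).

Definition weight (P : list (nat * nat)) (beta t : nat) : R :=
  lsum (fun us => prob beta (t - snd us)) P.

Definition wakes (P : list (nat * nat)) (t : nat) (w : nat * nat * nat -> bool) : Prop :=
  exists beta, (beta < b)%nat /\ count_is 1 (step_bits P beta t) w = true.

(** The last clause says that half of [2 ^ m] stations are active when the window opens; the doubled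
    count also covers [m = 0], where it asks for one station. *)
Definition valid (n m : nat) (P : list (nat * nat)) : Prop :=
  NoDup (map fst P) /\ (length P <= Nat.pow 2 m)%nat /\
  (forall us, In us P -> (fst us < n)%nat /\ (snd us < horizon m)%nat) /\
  (Nat.pow 2 m <= 2 * length (filter (fun us => Nat.leb (snd us) (window_start m)) P))%nat.

Definition all_bits (n : nat) : list (nat * nat * nat) :=
  list_prod (list_prod (seq 0 n) (seq 0 b)) (seq 1 (horizon L)).

Lemma weight_step_bits (P : list (nat * nat)) (beta t : nat) :
  lsum bit_prob (step_bits P beta t) = weight P beta t.
Proof.
  unfold step_bits, weight. rewrite lsum_map, lsum_filter. apply lsum_ext.
  intros us _. destruct (Nat.ltb_spec (snd us) t) as [H|H]; [easy|].
  now replace (t - snd us)%nat with O by lia.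
Qed.

Lemma NoDup_map_fst_inj {A B : Type} (P : list (A * B)) (x : A) (y y' : B) :
  NoDup (map fst P) -> In (x, y) P -> In (x, y') P -> y = y'.
Proof.
  induction P as [|[x0 y0] P IH]; simpl; [easy|].
  intros Hnd H1 H2. inversion Hnd as [|? ? Hx Hnd']; subst.
  destruct H1 as [E1|H1], H2 as [E2|H2]; [congruence| | |auto]; exfalso; apply Hx.
  - injection E1 as -> _. apply (in_map fst _ _ H2).
  - injection E2 as -> _. apply (in_map fst _ _ H1).
Qed.

Lemma NoDup_step_bits (P : list (nat * nat)) (beta t : nat) :
  NoDup (map fst P) -> NoDup (step_bits P beta t).
Proof.
  intros Hnd. unfold step_bits. apply (NoDup_map_inv (fun x => fst (fst x))).
  rewrite map_map. simpl. induction P as [|[u s] P IH]; simpl in *; [constructor|].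
  inversion Hnd as [|? ? Hu Hnd']; subst.
  destruct (Nat.ltb s t); simpl; auto. constructor; auto.
  intros H. apply Hu. apply in_map_iff in H as (us & E & Hus).
  apply filter_In in Hus as [Hus _]. rewrite <- E. now apply in_map.
Qed.

(** A delay only loses the last, nonnegative values; truncated subtraction sends the first [s] steps
    to [f O = 0]. *)
Lemma sum_shift_le (f : nat -> R) (s N : nat) :
  (forall j, 0 <= f j) -> f O = 0 ->
  lsum (fun t => f (t - s)%nat) (seq 1 N) <= lsum f (seq 1 N).
Proof.
  intros Hf H0.
  assert (E : lsum (fun t => f (t - s)%nat) (seq 1 N) = lsum f (seq 1 (N - s))).
  { induction N as [|N IH]; [easy|]. rewrite seq_S, lsum_app, IH.
    cbn [lsum fold_right]. destruct (Nat.le_gt_cases s N) as [H|H].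
    - replace (S N - s)%nat with (S (N - s)) by lia. rewrite seq_S, lsum_app.
      cbn [lsum fold_right]. now replace (1 + N - s)%nat with (1 + (N - s))%nat by lia.
    - replace (1 + N - s)%nat with O by lia.
      replace (S N - s)%nat with O by lia. replace (N - s)%nat with O by lia.
      rewrite H0; simpl; lra. }
  rewrite E. replace N with ((N - s) + (N - (N - s)))%nat at 2 by lia.
  rewrite seq_app, lsum_app. assert (H := lsum_nonneg f (seq (1 + (N - s)) (N - (N - s)))).
  specialize (H ltac:(auto)). lra.
Qed.

(** * Channels of moderate weight *)

Lemma total_weight_le (n m : nat) (P : list (nat * nat)) : (m <= L)%nat -> valid n m P ->
  lsum (weight P (b - 1)) (seq 1 (horizon m)) <= INR (horizon m).
Proof.
  intros Hm (_ & Hlen & _). unfold weight.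
  rewrite (lsum_swap (fun t us => prob (b - 1) (t - snd us))).
  apply Rle_trans with (lsum (fun _ : nat * nat => INR D * aR m) P).
  - apply lsum_le. intros us _.
    eapply Rle_trans; [|apply load_le, Hm].
    apply (sum_shift_le (prob (b - 1))); [|easy]. intros; apply prob_pos.
  - rewrite lsum_const, INR_horizon. apply le_INR in Hlen. rewrite pow_INR in Hlen.
    change (INR 2) with 2 in Hlen. pose proof (aR_ge1 m). pose proof (pos_INR D).
    replace (INR D * (2 ^ m * aR m)) with (2 ^ m * (INR D * aR m)) by ring.
    apply Rmult_le_compat_r; [nra|easy].
Qed.

(** Markov's inequality: the weight exceeds 4 in at most a quarter of [horizon m] steps, while the
    window holds at least half of them. *)
Lemma good_steps (n m : nat) (P : list (nat * nat)) : (m <= L)%nat -> valid n m P ->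
  exists ts, NoDup ts /\ INR (horizon m) <= 4 * INR (length ts) /\
    forall t, In t ts -> (window_start m < t <= horizon m)%nat /\ weight P (b - 1) t <= 4.
Proof.
  intros Hm Hv. pose proof (total_weight_le n m P Hm Hv) as Ht.
  pose proof (window_start_half m) as Hw. set (H := horizon m) in *.
  set (s := window_start m) in *.
  set (good := fun t => if Rle_dec (weight P (b - 1) t) 4 then true else false).
  exists (filter good (seq (1 + s) (H - s))). split; [|split].
  - apply NoDup_filter, seq_NoDup.
  - assert (Hbad : 4 * INR (length (filter (fun t => negb (good t)) (seq (1 + s) (H - s))))
                   <= INR H).
    { eapply Rle_trans; [|exact Ht].
      assert (Hpos : forall t, 0 <= weight P (b - 1) t)
        by (intros; apply lsum_nonneg; intros; apply prob_pos).
      replace H with (s + (H - s))%nat at 2 by lia. rewrite seq_app, lsum_app.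
      pose proof (lsum_nonneg _ (seq 1 s) (fun x _ => Hpos x)).
      pose proof (lsum_filter_le (fun t => negb (good t)) _ (seq (1 + s) (H - s))
                    (fun x _ => Hpos x)) as Hf.
      rewrite Rmult_comm, <- lsum_const.
      enough (lsum (fun _ => 4) (filter (fun t => negb (good t)) (seq (1 + s) (H - s)))
        <= lsum (weight P (b - 1)) (filter (fun t => negb (good t)) (seq (1 + s) (H - s))))
        by lra.
      apply lsum_le. intros t Hin. apply filter_In in Hin as [_ Hg]. unfold good in Hg.
      destruct (Rle_dec _ _); [easy|lra]. }
    pose proof (filter_length good (seq (1 + s) (H - s))) as Hl.
    rewrite length_seq in Hl.
    apply le_INR in Hw. rewrite mult_INR in Hw. change (INR 2) with 2 in Hw.
    apply (f_equal INR) in Hl. rewrite plus_INR, minus_INR in Hl; [lra|].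
    pose proof (window_start_half m). unfold s, H. lia.
  - intros t Hin. apply filter_In in Hin as [Hin Hg]. apply in_seq in Hin.
    unfold good in Hg. destruct (Rle_dec _ _); [|easy]. split; [lia|easy].
Qed.

Lemma first_weight_ge (n m t : nat) (P : list (nat * nat)) : valid n m P ->
  (window_start m < t <= horizon m)%nat -> / (4 * aR m) <= weight P 0 t.
Proof.
  intros (_ & _ & _ & Hc) Ht. unfold weight.
  set (q := fun us : nat * nat => Nat.leb (snd us) (window_start m)) in *.
  eapply Rle_trans; [|apply (lsum_filter_le q); intros; apply prob_pos].
  apply Rle_trans with (lsum (fun _ => / (2 ^ m * (2 * aR m))) (filter q P)).
  - rewrite lsum_const. apply le_INR in Hc. rewrite mult_INR, pow_INR in Hc.
    change (INR 2) with 2 in Hc. pose proof (aR_ge1 m). assert (0 < 2 ^ m) by (apply pow_lt; lra).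
    apply Rmult_le_reg_r with (4 * aR m * 2 ^ m); [nra|].
    replace (/ (4 * aR m) * (4 * aR m * 2 ^ m)) with (2 ^ m) by (field; lra).
    eapply Rle_trans; [exact Hc|]. right. field. lra.
  - apply lsum_le. intros us Hus. apply filter_In in Hus as [_ Hus].
    (* As [window_start m < t] is strict, these stations are in local round 1 or later, past the
       default value 0 of [prob]. *)
    apply Nat.leb_le in Hus. apply prob_first_ge; lia.
Qed.

(* Passing to the next channel divides the weight by at most [2 * aR m]. *)
Lemma balanced_channel (n m t : nat) (P : list (nat * nat)) : valid n m P ->
  (window_start m < t <= horizon m)%nat -> weight P (b - 1) t <= 4 ->
  exists beta, (beta < b)%nat /\ / (4 * aR m) <= weight P beta t <= 4.
Proof.
  intros Hv Ht Hlast. pose proof (aR_ge1 m) as Ha.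
  enough (H : forall c, weight P c t <= 4 ->
    exists beta, (beta <= c)%nat /\ / (4 * aR m) <= weight P beta t <= 4).
  { destruct (H _ Hlast) as (beta & H1 & H2). exists beta. split; [lia|easy]. }
  induction c as [|c IH]; intros Hc.
  - exists O. split; [easy|]. split; [|easy]. now apply (first_weight_ge n).
  - destruct (Rle_lt_dec (weight P c t) 4) as [H|H].
    + destruct (IH H) as (beta & H1 & H2). exists beta. split; [lia|easy].
    (* The weight drops through 4 between [c] and [S c], so on [S c] it is still at least
       [4 / (2 * aR m)]. *)
    + exists (S c). split; [easy|]. split; [|easy].
      apply Rle_trans with (weight P c t * / (2 * aR m)).
      * rewrite !Rinv_mult. assert (0 < / aR m) by (apply Rinv_0_lt_compat; lra). nra.
      * unfold weight. rewrite Rmult_comm, <- lsum_mult_l. apply lsum_le.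
        intros us _. rewrite Rmult_comm. apply prob_next_ge. lia.
Qed.

(** * Failure probability of one pattern and of all patterns *)

Lemma wakes_likely (n m : nat) (P : list (nat * nat)) : (m <= L)%nat -> valid n m P ->
  fails_within coord_dec bit_prob (all_bits n) (exp (- (INR D * 2 ^ m * (exp (- 8) / 16))))
    (fun w => exists t, (1 <= t <= horizon m)%nat /\ wakes P t w).
Proof.
  intros Hm Hv. destruct (good_steps n m P Hm Hv) as (ts & Hnd & Hlen & Hgood).
  set (ok := fun t beta => (beta < b)%nat /\ / (4 * aR m) <= weight P beta t <= 4).
  set (ch := fun t => epsilon (inhabits O) (ok t)).
  assert (Hch : forall t, In t ts -> ok t (ch t)).
  { intros t Ht. apply epsilon_spec. destruct (Hgood t Ht). now apply (balanced_channel n m). }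
  pose proof (aR_ge1 m) as Ha. destruct Hv as (HndP & _ & HP & _).
  assert (p01 : forall x, 0 <= bit_prob x <= 1).
  { intros x. pose proof (prob_pos (snd (fst x)) (snd x)).
    pose proof (prob_half (snd (fst x)) (snd x)). unfold bit_prob; lra. }
  (* A weight x between [/ (4 * aR m)] and 4 isolates with probability at least x exp(-2x), which is
     at least [q]. *)
  set (q := exp (- 8) / (4 * aR m)).
  assert (Hstep : forall t w, In t ts ->
    q <= expect coord_dec bit_prob (all_bits n)
           (fun w => indicator (count_is 1 (step_bits P (ch t) t) w)) w).
  { intros t w Ht. destruct (Hch t Ht) as (Hb & Hlo & Hhi). destruct (Hgood t Ht) as [Hwin _].
    eapply Rle_trans; [|apply expect_isolation; auto].
    - rewrite weight_step_bits. unfold q, Rdiv. rewrite Rmult_comm.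
      pose proof (Rinv_0_lt_compat (4 * aR m) ltac:(lra)).
      apply Rmult_le_compat; [lra|left; apply exp_pos|easy|].
      destruct Hhi as [Hhi| ->]; [left; apply exp_increasing; lra|].
      right; f_equal; lra.
    - now apply NoDup_step_bits.
    - intros x Hx. unfold step_bits in Hx. apply in_map_iff in Hx as (us & <- & Hus).
      apply filter_In in Hus as [Hus Hlt]. apply Nat.ltb_lt in Hlt.
      pose proof (HP us Hus). pose proof (horizon_mono m L Hm).
      repeat apply in_prod; apply in_seq; lia.
    - intros x _. apply prob_half. }
  set (f := fun t w => 1 - indicator (count_is 1 (step_bits P (ch t) t) w)).
  assert (Hf : forall t w, 0 <= f t w).
  { intros t w. unfold f, indicator. destruct (count_is _ _ _); lra. }
  assert (Hprod : forall us w, 0 <= fold_right (fun t s => f t w * s) 1 us).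
  { intros us w. induction us as [|t us IH]; simpl; [lra|]. specialize (Hf t w). nra. }
  (* The indicator of the event that every good step fails on its chosen channel. *)
  exists (fun w => fold_right (fun t s => f t w * s) 1 ts). split; [auto|split].
  - intros w.
    assert (HE : forall t w, In t ts ->
      0 <= expect coord_dec bit_prob (all_bits n) (f t) w <= exp (- q)).
    { intros t w' Ht. split.
      - rewrite <- (expect_const coord_dec bit_prob (all_bits n) 0 w').
        apply expect_mono; auto.
      - assert (E : expect coord_dec bit_prob (all_bits n) (f t) w' + q <= 1).
        { rewrite <- (expect_const coord_dec bit_prob (all_bits n) 1 w').
          eapply Rle_trans; [apply Rplus_le_compat_l, (Hstep t w' Ht)|].
          rewrite <- expect_add. apply expect_mono; auto. intros w0. unfold f. lra. }
        assert (0 < q).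
        { unfold q. apply Rmult_lt_0_compat; [apply exp_pos|apply Rinv_0_lt_compat; lra]. }
        pose proof (exp_ineq1 (- q) ltac:(lra)). lra. }
    destruct (expect_prod coord_dec bit_prob
                (fun t x => In x (step_bits P (ch t) t)) f (all_bits n) (exp (- q)) ts w)
      as [_ HE']; auto.
    + intros t _ w1 w2 Hw. unfold f. f_equal.
      now apply (count_is_depends 1 (step_bits P (ch t) t)).
    (* A shared entry has the same station and local round; a station has a single activation time
       in [P], so the steps agree. *)
    + intros t t' x _ _ Hx Hx'. unfold step_bits in Hx, Hx'.
      apply in_map_iff in Hx as ([u s] & <- & Hus).
      apply in_map_iff in Hx' as ([u' s'] & E & Hus').
      apply filter_In in Hus as [Hus Hlt]. apply filter_In in Hus' as [Hus' Hlt'].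
      apply Nat.ltb_lt in Hlt, Hlt'. simpl in *. injection E as -> _ E.
      rewrite (NoDup_map_fst_inj P u s s' HndP Hus Hus') in *. lia.
    + eapply Rle_trans; [exact HE'|].
      rewrite exp_pow, <- Ropp_mult_distr_r.
      assert (Hle : INR D * 2 ^ m * (exp (-8) / 16) <= INR (length ts) * q).
      { rewrite INR_horizon in Hlen. unfold q. pose proof (exp_pos (-8)).
        apply Rmult_le_reg_r with (16 * aR m); [lra|].
        replace (INR D * 2 ^ m * (exp (-8) / 16) * (16 * aR m))
          with (INR D * (2 ^ m * aR m) * exp (-8)) by field.
        replace (INR (length ts) * (exp (-8) / (4 * aR m)) * (16 * aR m))
          with (4 * INR (length ts) * exp (-8)) by (field; lra).
        apply Rmult_le_compat_r; lra. }
      destruct Hle as [Hle| ->]; [left; apply exp_increasing; lra|lra].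
  - intros w Hw.
    assert (He : exists t, In t ts /\ f t w < 1).
    { clear -Hw Hf Hprod. apply NNPP. intros N.
      enough (1 <= fold_right (fun t s => f t w * s) 1 ts) by lra.
      assert (H : forall t, In t ts -> 1 <= f t w).
      { intros t Ht. apply Rnot_lt_le. intros Hlt. apply N. now exists t. }
      clear N Hw. induction ts as [|t ts IH]; simpl; [lra|].
      assert (1 <= f t w) by (apply H; now left).
      assert (1 <= fold_right (fun t s => f t w * s) 1 ts) by (apply IH; intros; apply H; now right).
      nra. }
    destruct He as (t & Ht & Hlt). exists t. destruct (Hgood t Ht) as [Hwin _]. split; [lia|].
    exists (ch t). split; [apply Hch, Ht|]. unfold f, indicator in Hlt.
    destruct (count_is 1 (step_bits P (ch t) t) w); [easy|lra].
Qed.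

(** The hypothesis bounds the number of cells plus one. Raised to the power [2 ^ m] and multiplied
    by the failure probability, it leaves at most exp(-2^m), which is at most [(1 / 2) ^ S m]; these
    sum to less than 1 over all scales. *)
Lemma array_exists (n : nat) :
  INR (n * horizon L) + 1 <= exp (INR D * (exp (- 8) / 16) - 1) ->
  exists w, forall m P, (m <= L)%nat -> valid n m P ->
    exists t, (1 <= t <= horizon m)%nat /\ wakes P t w.
Proof.
  intros Hbig. set (kappa := exp (- 8) / 16) in *.
  set (cells := fun m => list_prod (seq 0 n) (seq 0 (horizon m))).
  set (Q := fun m P w => valid n m P -> exists t, (1 <= t <= horizon m)%nat /\ wakes P t w).
  set (e := fun m (_ : list (nat * nat)) => exp (- (INR D * 2 ^ m * kappa))).
  assert (HF : fails_within coord_dec bit_prob (all_bits n)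
    (lsum (fun m => lsum (e m) (lists_upto (cells m) (Nat.pow 2 m))) (seq 0 (S L)))
    (fun w => forall m, In m (seq 0 (S L)) ->
       forall P, In P (lists_upto (cells m) (Nat.pow 2 m)) -> Q m P w)).
  { apply (fails_within_all coord_dec bit_prob (all_bits n) _
       (fun m w => forall P, In P (lists_upto (cells m) (Nat.pow 2 m)) -> Q m P w)).
    intros m Hm. apply in_seq in Hm. apply fails_within_all. intros P _.
    destruct (classic (valid n m P)) as [Hv|Hv].
    - destruct (wakes_likely n m P ltac:(lia) Hv) as (f & f0 & fe & fQ).
      exists f. split; [easy|]. split; [easy|]. intros w Hw _. auto.
    - exists (fun _ => 0). split; [intros; lra|]. split; [|intros w _ Hv'; easy].
      intros w. rewrite expect_const. left; apply exp_pos. }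
  assert (Hsum : lsum (fun m => lsum (e m) (lists_upto (cells m) (Nat.pow 2 m))) (seq 0 (S L)) < 1).
  { apply Rle_lt_trans with (lsum (fun m => (1 / 2) ^ S m) (seq 0 (S L))).
    - apply lsum_le. intros m Hm. apply in_seq in Hm. unfold e.
      rewrite lsum_const, length_lists_upto, pow_INR.
      assert (Hcell : INR (S (length (cells m))) <= exp (INR D * kappa - 1)).
      { eapply Rle_trans; [|exact Hbig]. rewrite S_INR. apply Rplus_le_compat_r, le_INR.
        unfold cells. rewrite length_prod, !length_seq.
        apply Nat.mul_le_mono_l, horizon_mono. lia. }
      apply Rle_trans with (exp (INR D * kappa - 1) ^ (Nat.pow 2 m)
                            * exp (- (INR D * 2 ^ m * kappa))).
      { apply Rmult_le_compat_r; [left; apply exp_pos|]. apply pow_incr.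
        split; [apply pos_INR|easy]. }
      rewrite exp_pow, <- exp_plus, pow_INR. change (INR 2) with 2.
      replace (2 ^ m * (INR D * kappa - 1) + - (INR D * 2 ^ m * kappa))
        with (- (2 ^ m * 1)) by ring.
      rewrite exp_Ropp. change 2 with (INR 2) at 1. rewrite <- pow_INR, <- exp_pow.
      unfold Rdiv. rewrite Rmult_1_l, pow_inv. apply Rinv_le_contravar; [apply pow_lt; lra|].
      pose proof two_le_exp1.
      apply Rle_trans with (2 ^ Nat.pow 2 m); [|apply pow_incr; lra].
      apply Rle_pow; [lra|]. apply Nat.pow_gt_lin_r; lia.
    - enough (E : forall N, lsum (fun m => (1 / 2) ^ S m) (seq 0 N) = 1 - (1 / 2) ^ N).
      { rewrite E. pose proof (pow_lt (1 / 2) (S L) ltac:(lra)). lra. }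
      induction N as [|N IH]; [simpl; lra|].
      rewrite seq_S, lsum_app, IH. simpl. lra. }
  destruct HF as (F & F0 & FE & FQ).
  destruct (expect_lt_exists coord_dec bit_prob) with (l := all_bits n) (f := F)
    (w := fun _ : nat * nat * nat => false) (c := 1) as [w Hw].
  { intros x. pose proof (prob_pos (snd (fst x)) (snd x)).
    pose proof (prob_half (snd (fst x)) (snd x)). unfold bit_prob; lra. }
  { eapply Rle_lt_trans; [apply FE|exact Hsum]. }
  exists w. intros m P Hm Hv. apply (FQ w Hw m); [apply in_seq; lia| |easy].
  destruct Hv as (_ & Hlen & HP & _). apply in_lists_upto; [easy|].
  intros [u s] Hus. destruct (HP _ Hus). simpl in *. apply in_prod; apply in_seq; lia.
Qed.

(** * From activation patterns to valid lists *)

Definition arrivals (A : list nat) (sigma : nat -> nat) (t0 m : nat) : list (nat * nat) :=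
  map (fun v => (v, (sigma v - t0)%nat))
    (filter (fun v => Nat.ltb (sigma v - t0) (horizon m)) A).

Lemma length_arrivals_le (A : list nat) (sigma : nat -> nat) (t0 m : nat) :
  (length (arrivals A sigma t0 m) <= length A)%nat.
Proof. unfold arrivals. rewrite length_map. apply filter_length_le. Qed.

Lemma arrivals_valid (n : nat) (A : list nat) (sigma : nat -> nat) (t0 : nat) :
  (n <= Nat.pow 2 L)%nat -> NoDup A -> (forall u, In u A -> (u < n)%nat) ->
  (exists u, In u A /\ sigma u = t0) ->
  exists m, (m <= L)%nat /\ valid n m (arrivals A sigma t0 m)
    /\ (Nat.pow 2 m <= 2 * length A)%nat.
Proof.
  intros Hn Hnd HA (u0 & Hu0 & Ht0).
  assert (Hmin : exists m, (m <= L)%nat /\ (length (arrivals A sigma t0 m) <= Nat.pow 2 m)%nat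
    /\ match m with
       | O => True
       | S m' => (Nat.pow 2 m' < length (arrivals A sigma t0 m'))%nat
       end).
  { assert (Htop : (length (arrivals A sigma t0 L) <= Nat.pow 2 L)%nat).
    { eapply Nat.le_trans; [apply length_arrivals_le|].
      eapply Nat.le_trans; [|exact Hn]. rewrite <- (length_seq n 0).
      apply NoDup_incl_length; [easy|]. intros u Hu. apply in_seq.
      specialize (HA u Hu). lia. }
    (* Descending from [L], the search stops at a scale whose predecessor has too many arrivals. *)
    clear Hn. revert Htop. generalize L. intros M. induction M as [|M IH]; intros Htop.
    - exists O. auto.
    - destruct (Nat.le_gt_cases (length (arrivals A sigma t0 M)) (Nat.pow 2 M)) as [H|H].
      + destruct (IH H) as (m & H1 & H2). exists m. split; [lia|easy].
      + exists (S M). auto. }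
  destruct Hmin as (m & Hm & Hle & Hprev). exists m. split; [easy|].
  assert (Hcount : forall q : nat * nat -> bool,
    length (filter q (arrivals A sigma t0 m))
    = length (filter (fun v => q (v, (sigma v - t0)%nat))
                (filter (fun v => Nat.ltb (sigma v - t0) (horizon m)) A))).
  { intros q. unfold arrivals. generalize (filter (fun v => Nat.ltb (sigma v - t0) (horizon m)) A).
    intros l. induction l as [|v l IH]; simpl; [easy|].
    destruct (q _); simpl; now rewrite IH. }
  split; [split; [|split; [easy|split]]|].
  - unfold arrivals. rewrite map_map. simpl. rewrite map_id. now apply NoDup_filter.
  - intros us Hus. unfold arrivals in Hus. apply in_map_iff in Hus as (v & <- & Hv).
    apply filter_In in Hv as [Hv Hlt]. apply Nat.ltb_lt in Hlt. simpl. auto.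
  - rewrite Hcount. destruct m as [|m].
    (* At scale 0 the station activated first is itself the one required. *)
    + assert (Hin : In u0 (filter (fun v => Nat.leb (sigma v - t0) 0)
                (filter (fun v => Nat.ltb (sigma v - t0) (horizon 0)) A))).
      { apply filter_In. split; [apply filter_In; split; [easy|]|].
        - apply Nat.ltb_lt. unfold horizon. simpl. lia.
        - apply Nat.leb_le. lia. }
      simpl in *. destruct (filter _ (filter _ A)); [easy|]. simpl. lia.
    + rewrite Nat.pow_succ_r'. apply Nat.mul_le_mono_l.
      eapply Nat.lt_le_incl, Nat.lt_le_trans; [exact Hprev|].
      unfold arrivals. rewrite length_map. apply NoDup_incl_length; [now apply NoDup_filter|].
      intros v Hv. apply filter_In in Hv as [Hv Hlt]. apply Nat.ltb_lt in Hlt.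
      pose proof (horizon_mono m (S m) ltac:(lia)).
      apply filter_In. split; [apply filter_In; split; [easy|]|].
      * apply Nat.ltb_lt. lia.
      * apply Nat.leb_le. simpl. lia.
  - destruct m as [|m].
    + destruct A; [easy|]. simpl. lia.
    + pose proof (length_arrivals_le A sigma t0 m). rewrite Nat.pow_succ_r'. lia.
Qed.

(** Stations missing from [arrivals] are still passive at step [t0 + t], because [t <= horizon m];
    for the others the local round is within [horizon L], so the array is not exhausted. Hence the
    true bits read are exactly the transmitters. *)
Lemma wakes_wakes_at (A : list nat) (sigma : nat -> nat) (t0 m t : nat)
    (w : nat * nat * nat -> bool) : (m <= L)%nat ->
  (forall v, In v A -> (t0 <= sigma v)%nat) -> (t <= horizon m)%nat ->
  wakes (arrivals A sigma t0 m) t w ->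
  wakes_at b (horizon L) (fun u beta j => w (u, beta, j)) A sigma (t0 + t).
Proof.
  intros Hm Hs Ht (beta & Hb & Hc). exists beta. split; [easy|].
  unfold count_is in Hc. apply Nat.eqb_eq in Hc.
  assert (Hmem : forall x, In x (filter w (step_bits (arrivals A sigma t0 m) beta t)) <->
    exists v, x = (v, beta, (t0 + t - sigma v)%nat) /\
      transmits (horizon L) (fun u beta j => w (u, beta, j)) A sigma v beta (t0 + t)).
  { intros x. rewrite filter_In. unfold step_bits, arrivals, transmits.
    pose proof (horizon_mono m L Hm). split.
    - intros [Hx Hw]. apply in_map_iff in Hx as ([v s] & <- & Hx).
      apply filter_In in Hx as [Hx Hlt]. apply Nat.ltb_lt in Hlt.
      apply in_map_iff in Hx as (v' & [= -> <-] & Hv). apply filter_In in Hv as [Hv _].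
      simpl in *. specialize (Hs v Hv). exists v.
      replace (t - (sigma v - t0))%nat with (t0 + t - sigma v)%nat in * by lia.
      repeat split; auto; lia.
    - intros (v & -> & Hv & H1 & H2 & H3). split; [|easy]. specialize (Hs v Hv).
      apply in_map_iff. exists (v, (sigma v - t0)%nat). split.
      + simpl. f_equal. lia.
      + apply filter_In. split; [|apply Nat.ltb_lt; simpl; lia].
        apply in_map_iff. exists v. split; [easy|].
        apply filter_In. split; [easy|]. apply Nat.ltb_lt. lia. }
  destruct (filter w _) as [|x [|y l]]; try discriminate Hc.
  destruct (proj1 (Hmem x) (or_introl eq_refl)) as (u & -> & Hu).
  exists u. split; [easy|]. intros v Hv.
  destruct (proj2 (Hmem (v, beta, (t0 + t - sigma v)%nat))) as [E|[]].
  - now exists v.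
  - now injection E.
Qed.

End Array.

(** * Choice of the parameters *)

Lemma ln2_pos : 0 < ln 2.
Proof. rewrite <- ln_1. apply ln_increasing; lra. Qed.

Lemma lg_ge1 (x : nat) : 1 <= lg x.
Proof. apply Rmax_l. Qed.

(** [m] is at most 1 + log k, and the 1 is absorbed because [lg] is clamped below by 1. *)
Lemma exponent_le_lg (m k : nat) : (1 <= k)%nat -> (Nat.pow 2 m <= 2 * k)%nat ->
  INR m <= 2 * lg k.
Proof.
  intros Hk Hm. pose proof ln2_pos as H2.
  assert (Hk' : 0 < INR k) by (apply lt_0_INR; lia).
  apply le_INR in Hm. rewrite pow_INR, mult_INR in Hm. change (INR 2) with 2 in Hm.
  assert (Hln : INR m * ln 2 <= ln 2 + ln (INR k)).
  { rewrite <- ln_mult, <- ln_pow by lra.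
    destruct Hm as [Hm| ->]; [left; apply ln_increasing; [apply pow_lt; lra|easy]|lra]. }
  assert (INR m <= 1 + ln (INR k) / ln 2).
  { apply Rmult_le_reg_r with (ln 2); [easy|].
    replace ((1 + ln (INR k) / ln 2) * ln 2) with (ln 2 + ln (INR k)) by (field; lra). easy. }
  pose proof (Rmax_l 1 (ln (INR k) / ln 2)). pose proof (Rmax_r 1 (ln (INR k) / ln 2)).
  unfold lg. lra.
Qed.

(** With [r >= 1], a root above 4r would give (root - 1)^b at least 3^b [lg k], more than the bound
    [2 * lg k] on [m]. *)
Lemma root_le_Rpower (b m k : nat) : (1 <= b)%nat -> INR m <= 2 * lg k ->
  INR (root b m) <= 4 * Rpower (lg k) (1 / INR b).
Proof.
  intros Hb Hm. destruct (root_spec b m Hb) as (H1 & _ & H3).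
  pose proof (lg_ge1 k) as Hlg. set (r := Rpower (lg k) (1 / INR b)).
  assert (Hb' : 1 <= INR b) by (apply (le_INR 1); easy).
  assert (Hr : r ^ b = lg k).
  { rewrite <- Rpower_pow by apply exp_pos. unfold r. rewrite Rpower_mult.
    replace (1 / INR b * INR b) with 1 by (field; lra). apply Rpower_1. lra. }
  assert (Hr1 : 1 <= r).
  { unfold r. rewrite <- (Rpower_O (lg k)) at 1 by lra. apply Rle_Rpower; [easy|].
    left. apply Rmult_lt_0_compat; [lra|apply Rinv_0_lt_compat; lra]. }
  apply Rnot_lt_le. intros Hlt.
  assert (Hpow : (3 * r) ^ b <= (INR (root b m) - 1) ^ b) by (apply pow_incr; lra).
  apply le_INR in H3. rewrite pow_INR, minus_INR in H3 by easy. change (INR 1) with 1 in H3.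
  rewrite Rpow_mult_distr, Hr in Hpow.
  assert (3 <= 3 ^ b) by (rewrite <- (pow_1 3) at 1; apply Rle_pow; [lra|easy]). nra.
Qed.

Lemma top_level_exists (n : nat) : (1 <= n)%nat ->
  exists L, (1 <= L)%nat /\ (n <= Nat.pow 2 L)%nat /\ (Nat.pow 2 L <= 2 * n)%nat.
Proof.
  (* [Nat.log2_up 1] is 0, but a positive [L] is required so that [D = C * L] is positive. *)
  intros Hn. destruct (Nat.eq_dec n 1) as [->|H1]; [exists 1%nat; simpl; lia|].
  exists (Nat.log2_up n). destruct (Nat.log2_up_spec n ltac:(lia)) as [Ha Hb].
  pose proof (Nat.log2_up_pos n ltac:(lia)). split; [easy|]. split; [easy|].
  replace (Nat.log2_up n) with (S (Nat.pred (Nat.log2_up n))) by lia.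
  rewrite Nat.pow_succ_r'. lia.
Qed.

(* [3359232 = 16 * 3 ^ 8 * 32], so that [INR C * (exp (- 8) / 16) >= 32]. *)
Lemma patterns_bound (n b C L : nat) : INR C = 3359232 -> (1 <= L)%nat ->
  (n <= Nat.pow 2 L)%nat ->
  INR (n * horizon b (C * L) L) + 1 <= exp (INR (C * L) * (exp (- 8) / 16) - 1).
Proof.
  intros HC HL Hn.
  assert (HL' : 1 <= INR L) by (apply (le_INR 1); easy).
  assert (Hl : (L < Nat.pow 2 L)%nat) by (apply Nat.pow_gt_lin_r; lia).
  pose proof (root_le b L) as Hr.
  (* Each of [n], [L], [2 ^ L] and the root is at most [2 ^ L]. *)
  assert (Hnat : (n * horizon b (C * L) L <= C * Nat.pow 2 (4 * L))%nat).
  { replace (4 * L)%nat with (L + L + (L + L))%nat by lia. rewrite !Nat.pow_add_r.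
    unfold horizon. set (p := Nat.pow 2 L) in *.
    apply Nat.le_trans with (p * (C * p * (p * p)))%nat; [|nia].
    apply Nat.mul_le_mono; [easy|]. apply Nat.mul_le_mono; [nia|].
    apply Nat.mul_le_mono_l. lia. }
  apply le_INR in Hnat. rewrite (mult_INR C), pow_INR, HC in Hnat. change (INR 2) with 2 in Hnat.
  pose proof two_le_exp1 as H2. pose proof exp_le_3 as H3.
  assert (H4 : 1 <= 2 ^ (4 * L)) by (apply pow_R1_Rle; lra).
  (* [2 ^ 23] exceeds 3359232 + 1; the exponents then compare as 23 + 4L against 32L - 1, with L at
     least 1. *)
  apply Rle_trans with (2 ^ 23 * 2 ^ (4 * L)); [lra|].
  rewrite <- pow_add.
  apply Rle_trans with (exp 1 ^ (23 + 4 * L)); [apply pow_incr; lra|].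
  rewrite exp_pow, plus_INR, !mult_INR, HC.
  assert (H8 : / 6561 <= exp (- 8)).
  { replace (-8) with (Ropp 8) by lra. rewrite exp_Ropp.
    apply Rinv_le_contravar; [apply exp_pos|].
    replace 8 with (INR 8 * 1) by (simpl; ring). rewrite <- exp_pow.
    replace 6561 with (3 ^ 8) by ring. apply pow_incr. split; [left; apply exp_pos|easy]. }
  assert (Hle : (INR 23 + INR 4 * INR L) * 1 <= 3359232 * INR L * (exp (-8) / 16) - 1).
  { assert (3359232 * INR L * (/ 6561 / 16) <= 3359232 * INR L * (exp (-8) / 16))
      by (apply Rmult_le_compat_l; lra).
    replace (INR 23) with 23 by (simpl; ring). replace (INR 4) with 4 by (simpl; ring). lra. }
  destruct Hle as [Hle| ->]; [left; now apply exp_increasing|lra].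
Qed.

(** Serves twice: for the array length with [m = L], [k = n], and for the wake-up time. The 16 is 2
    for [L], 2 for [2 ^ m] and 4 for the root. *)
Lemma horizon_le (b C L n m k : nat) : (1 <= b)%nat -> (1 <= n)%nat -> (1 <= k)%nat ->
  (Nat.pow 2 L <= 2 * n)%nat -> (Nat.pow 2 m <= 2 * k)%nat ->
  INR (horizon b (C * L) m) <= 16 * INR C * INR k * lg n * Rpower (lg k) (1 / INR b).
Proof.
  intros Hb Hn Hk HL Hm.
  pose proof (exponent_le_lg L n Hn HL) as H1. pose proof (exponent_le_lg m k Hk Hm) as H2.
  pose proof (root_le_Rpower b m k Hb H2) as H3.
  apply le_INR in Hm. rewrite pow_INR, mult_INR in Hm. change (INR 2) with 2 in Hm.
  unfold horizon. rewrite !mult_INR, pow_INR. change (INR 2) with 2.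
  set (r := Rpower _ _) in *.
  replace (16 * INR C * INR k * lg n * r)
    with (INR C * (2 * lg n) * ((2 * INR k) * (4 * r))) by ring.
  assert (0 <= 2 ^ m) by (apply pow_le; lra).
  pose proof (pos_INR C). pose proof (pos_INR L). pose proof (pos_INR (root b m)).
  apply Rmult_le_compat; [nra|nra| |apply Rmult_le_compat; lra].
  apply Rmult_le_compat_l; lra.
Qed.

Theorem theorem3 :
  exists c1 c2 : R, 0 < c1 /\ 0 < c2 /\
  forall n b : nat, (1 <= n)%nat -> (1 <= b)%nat ->
  exists (ell : nat) (T : tarray),
    INR ell <= c1 * INR n * lg n * Rpower (lg n) (1 / INR b) /\
    forall (k : nat) (A : list nat) (sigma : nat -> nat) (t0 : nat),
      (k <= n)%nat ->
      NoDup A -> A <> nil -> (length A <= k)%nat ->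
      (forall u, In u A -> (u < n)%nat) ->
      (exists u, In u A /\ sigma u = t0) ->
      (forall v, In v A -> (t0 <= sigma v)%nat) ->
      exists t : nat, wakes_at b ell T A sigma t /\
        INR (t - t0) <= c2 * INR k * lg n * Rpower (lg k) (1 / INR b).
Proof.
  assert (HC : exists C, INR C = 3359232).
  { exists (Z.to_nat 3359232). (* a [nat] literal would be unary *)
    rewrite INR_IZR_INZ, Znat.Z2Nat.id by lia. easy. }
  destruct HC as [C HC].
  exists (16 * INR C), (16 * INR C). split; [lra|]. split; [lra|].
  intros n b Hn Hb. destruct (top_level_exists n Hn) as (L & HL & HnL & HLn).
  assert (HD : (1 <= C * L)%nat).
  { assert (C <> 0)%nat by (intros ->; simpl in HC; lra). nia. }
  (* The array is fixed here, before [k]: it serves all scales up to [L] at once. *)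
  destruct (array_exists b (C * L) L Hb HD n (patterns_bound n b C L HC HL HnL)) as [w Hw].
  exists (horizon b (C * L) L), (fun u beta j => w (u, beta, j)).
  split; [now apply horizon_le|].
  intros k A sigma t0 Hkn Hnd HA HAk HAn Hfirst Hs.
  assert (Hk : (1 <= k)%nat) by (destruct A; [congruence|simpl in HAk; lia]).
  destruct (arrivals_valid b (C * L) L Hb HD n A sigma t0 HnL Hnd HAn Hfirst)
    as (m & Hm & Hv & Hmk).
  destruct (Hw m _ Hm Hv) as (t & Ht & Hwake).
  exists (t0 + t)%nat. split.
  - apply (wakes_wakes_at b (C * L) L) with (m := m); auto. lia.
  - replace (t0 + t - t0)%nat with t by lia.
    apply Rle_trans with (INR (horizon b (C * L) m)); [apply le_INR; lia|].
    apply (horizon_le b C L n m k); auto. lia.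
Qed.
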